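(* Let $d\in\{1,2,3\}$ and consider the $d$-dimensional special relativistic hydrodynamics (RHD) system with an equation of state $h=h(\theta)=1+e(\theta)+\theta$, $\theta=p/\rho$, satisfying $e'(\theta)>0$ and $h(\theta)>\theta(1+e'(\theta))/e'(\theta)$ for all $\theta>0$. Let $S:=-\ln\rho+\int^{\theta}\frac{e'(x)}{x}dx$, $\eta:=-DS$ and $\mathbf q:=-DS\,\mathbf v$. Then the entropy variables $\mathbf W:=\partial\eta/\partial\mathbf U$ associated with $\eta$ are $$\mathbf W=\frac1\theta\,\bigl(h-\theta S,\ \gamma\mathbf v^\top,\ -\gamma\bigr)^\top,$$ and the associated entropy potential fluxes $\psi_i:=\mathbf W^\top\mathbf F_i-q_i$ are $$\psi_i=\rho\gamma v_i,\qquad i=1,\dots,d .$$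
   Context: The RHD system is $\partial_t\mathbf U+\sum_{i=1}^d\partial_{x_i}\mathbf F_i(\mathbf U)=\mathbf 0$ with conservative variables $\mathbf U=(D,\mathbf m^\top,E)^\top\in\mathbb R^{d+2}$ and fluxes $\mathbf F_i(\mathbf U)=(Dv_i,\ v_i\mathbf m^\top+p\,\mathbf e_i^\top,\ m_i)^\top$, where $D=\rho\gamma$, $\mathbf m=\rho h\gamma^2\mathbf v$, $E=\rho h\gamma^2-p$. Here $\rho>0$ is the rest-mass density, $p>0$ the pressure, $\mathbf v=(v_1,\dots,v_d)^\top$ with $|\mathbf v|<1$ the velocity, $\gamma=(1-|\mathbf v|^2)^{-1/2}$, $\mathbf e_i$ the $i$-th column of the $d\times d$ identity matrix, $h$ the specific enthalpy, $e$ the specific internal energy, $\theta:=p/\rho$. The function $e$ is continuously differentiable on $(0,\infty)$. $\int^\theta \frac{e'(x)}{x}dx$ denotes a fixed antiderivative of $e'(\theta)/\theta$. All quantities are explicit functions of the primitive variables $\mathbf V=(\rho,\mathbf v^\top,p)^\top$ and are regarded as functions of $\mathbf U$ through the change of variables $\mathbf V\leftrightarrow\mathbf U$, so that $\partial(\cdot)/\partial\mathbf U=\partial(\cdot)/\partial\mathbf V\,(\partial\mathbf U/\partial\mathbf V)^{-1}$. *)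

(* Defs.v *)
From HB Require Import structures.
From mathcomp Require Import all_boot all_order all_algebra.
From mathcomp Require Import all_classical all_reals all_analysis.

Set Implicit Arguments.
Unset Strict Implicit.
Unset Printing Implicit Defensive.

Import Order.TTheory GRing.Theory Num.Theory.
Import numFieldNormedType.Exports.

Local Open Scope ring_scope.

Section PartialDerivatives.
Context {R : realType}.

(* (d f / d x)_(i, j) = d f_i / d x_j: the transpose of the library's
   [jacobian], which acts on row vectors. *)
Definition dmx {n m : nat} (f : 'cV[R]_n -> 'cV[R]_m) (x : 'cV[R]_n)
    : 'M[R]_(m, n) :=
  \matrix_(i, j) 'D_(delta_mx j 0) (fun y => f y i 0) x.

Definition drow {n : nat} (g : 'cV[R]_n -> R) (x : 'cV[R]_n) : 'rV[R]_n :=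
  \row_j 'D_(delta_mx j 0) g x.

(* d g / d U = (d g / d V) (d U / d V)^-1, for g and U given as functions
   of V.  [invmx] is the inverse only where [dmx U V] is invertible. *)
Definition drow_wrt {n : nat} (g : 'cV[R]_n -> R) (U : 'cV[R]_n -> 'cV[R]_n)
    (V : 'cV[R]_n) : 'rV[R]_n :=
  drow g V *m invmx (dmx U V).

(* [`|v|] on matrices is the sup norm, hence this definition. *)
Definition enorm {n : nat} (v : 'cV[R]_n) : R :=
  Num.sqrt (\sum_(i < n) v i 0 ^+ 2).

End PartialDerivatives.

Section RHD.
Context {R : realType} {d : nat}.

(* State vectors live in R^(d+2), split as 1 + (d + 1). *)
Definition state := 'cV[R]_(1 + (d + 1)).

Definition mkstate (a : R) (w : 'cV[R]_d) (b : R) : state :=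
  col_mx a%:M (col_mx w b%:M).

(* V = (rho, v^T, p)^T *)
Definition rho (V : state) : R := usubmx V 0 0.
Definition vel (V : state) : 'cV[R]_d := usubmx (dsubmx V).
Definition pres (V : state) : R := dsubmx (dsubmx V) 0 0.

Definition physical (V : state) : Prop :=
  [/\ 0 < rho V, enorm (vel V) < 1 & 0 < pres V].

Definition lorentz (V : state) : R := (Num.sqrt (1 - enorm (vel V) ^+ 2))^-1.

Definition theta (V : state) : R := pres V / rho V.

Definition enthalpy (e : R -> R) (t : R) : R := 1 + e t + t.

Section Equations.
Variable e : R -> R.

Definition massD (V : state) : R := rho V * lorentz V.

Definition momentum (V : state) : 'cV[R]_d :=
  (rho V * enthalpy e (theta V) * lorentz V ^+ 2) *: vel V.

Definition energy (V : state) : R :=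
  rho V * enthalpy e (theta V) * lorentz V ^+ 2 - pres V.

Definition consU (V : state) : state :=
  mkstate (massD V) (momentum V) (energy V).

Definition flux (i : 'I_d) (V : state) : state :=
  mkstate (massD V * vel V i 0)
          (vel V i 0 *: momentum V + pres V *: delta_mx i 0)
          (momentum V i 0).

(* [G] is the antiderivative of x |-> e'(x) / x. *)
Variable G : R -> R.

Definition entS (V : state) : R := - ln (rho V) + G (theta V).

Definition eta (V : state) : R := - (massD V * entS V).

Definition entflux (V : state) : 'cV[R]_d := - (massD V * entS V) *: vel V.

Definition entropy_vars (V : state) : state := (drow_wrt eta consU V)^T.

Definition potential_flux (i : 'I_d) (V : state) : R :=
  ((entropy_vars V)^T *m flux i V) 0 0 - entflux V i 0.

End Equations.
End RHD.

Arguments state R d : clear implicits.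

(* Main.v *)
Require Import Defs.
From mathcomp Require Import all_boot all_order all_algebra.
From mathcomp Require Import all_classical all_reals all_analysis.
From mathcomp Require Import ring lra.

Set Implicit Arguments.
Unset Strict Implicit.

Import Order.TTheory GRing.Theory Num.Theory.
Import numFieldNormedType.Exports.
Local Open Scope ring_scope.

(** Two ideas carry the proof.

    The differentials of U and eta are computed as functionals of an arbitrary
    direction x = (drho, dv, dp) instead of entry by entry.  Multiplying a
    Jacobian by x gives the differential at x ([mul_dmx], [mul_drow]), so each
    claim about matrices becomes a scalar identity.  With w = v . dv one has
    dgamma = gamma^3 w; with k = rho h gamma^2 one has m = k v and E = k - p,
    hence dm = k dv + (dk) v and dE = dk - dp.

    Invertibility of dU/dV ([dconsU_ker]): suppose dU = 0.  Then dk = dp, and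
    dm = 0 becomes k dv = - (dp) v, so w = - dp |v|^2 / k; with dD = 0 this
    gives drho = dp |v|^2 / h.  Every unknown is now a multiple of dp, and
    dk = dp reduces to dp (e' h - theta (1 + e') |v|^2) = 0.  The hypotheses
    e' > 0 and h > theta (1 + e') / e' together with |v| < 1 make the factor
    positive (the sound speed is less than that of light), so dp = 0 and the
    direction vanishes.

    The entropy variables ([deta_dconsU]): it is enough that d eta = W . dU in
    every direction, since dU/dV can then be cancelled.  Here
    v . dm - dE = - d(rho h) - k w + dp, so that
    h dD + gamma (v . dm - dE) = gamma (h drho - d(rho h) + dp)
                               = gamma (theta drho - rho e' dtheta),
    which is - theta D dS: the Gibbs relation for
    dS = - drho / rho + (e' / theta) dtheta.  The remaining term - S dD of
    d eta is the contribution of - theta S in the first entry of W.  The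
    potential fluxes then follow by substituting W. *)

(** * Pointwise rules for Frechet differentials *)

Section Calculus.
Context {R : realType} {E : normedModType R}.
Implicit Types (f g df dg : E -> R) (x : E).

Lemma is_diff_ext (F : normedModType R) (f df dg : E -> F) x :
  is_diff x f df -> df =1 dg -> is_diff x f dg.
Proof. by move=> fd /funext <-. Qed.

Lemma is_diff_const (a : R) x : is_diff x (fun _ : E => a) (fun=> 0).
Proof. exact: is_diff_cst. Qed.

(* The sum and product rules for [is_diff] are restated here on lambda
   abstractions, the form in which the physical quantities unfold. *)
Lemma is_diff_add f g df dg x : is_diff x f df -> is_diff x g dg ->
  is_diff x (fun y => f y + g y) (fun u => df u + dg u).
Proof. exact: is_diffD. Qed.

Lemma is_diff_opp f df x :
  is_diff x f df -> is_diff x (fun y => - f y) (fun u => - df u).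
Proof. exact: is_diffN. Qed.

Lemma is_diff_sub f g df dg x : is_diff x f df -> is_diff x g dg ->
  is_diff x (fun y => f y - g y) (fun u => df u - dg u).
Proof. exact: is_diffB. Qed.

Lemma is_diff_mul f g df dg x : is_diff x f df -> is_diff x g dg ->
  is_diff x (fun y => f y * g y) (fun u => df u * g x + f x * dg u).
Proof.
move=> fd gd; apply: (is_diff_ext (is_diffM fd gd)) => u.
by rewrite addrC; congr (_ + _); exact: mulrC.
Qed.

Lemma is_diff_chain (phi : R -> R) (a : R) f df x :
  is_diff x f df -> is_derive (f x) 1 phi a ->
  is_diff x (fun y => phi (f y)) (fun u => df u * a).
Proof.
move=> fd [phid phiE].
have phi_diff : differentiable phi (f x) by apply/derivable1_diffP.
have dphi : is_diff (f x) phi (fun h => h * a).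
  by apply: DiffDef => //; rewrite diff1E // derive1E phiE.
exact: (is_diff_comp fd dphi).
Qed.

Lemma is_diff_bigsum n (F dF : 'I_n -> E -> R) x :
  (forall i, is_diff x (F i) (dF i)) ->
  is_diff x (fun y => \sum_i F i y) (fun u => \sum_i dF i u).
Proof.
move=> Fd; have sumE (H : 'I_n -> E -> R) : (fun y => \sum_i H i y) = \sum_i H i.
  by rewrite fct_sumE.
rewrite !sumE.
elim/big_ind2 : _ => //.
  exact: is_diff_const.
by move=> f1 df1 f2 df2; exact: is_diffD.
Qed.

(** Vector-valued maps are differentiated componentwise: f is the sum of its
    components times the canonical basis vectors, which gives
    differentiability, and directional derivatives commute with taking
    entries, which identifies the differential. *)
Lemma is_diff_cV n (f df : E -> 'cV[R]_n) x :
  (forall i, is_diff x (fun y => f y i 0) (fun u => df u i 0)) ->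
  is_diff x f df.
Proof.
move=> fd.
have fdiff : differentiable f x.
  have -> : f = \sum_i (fun y => f y i 0 *: (delta_mx i 0 : 'cV[R]_n)).
    apply/funext => y; rewrite fct_sumE {1}[f y]matrix_sum_delta.
    by apply: eq_bigr => i _; rewrite big_ord1.
  by apply: differentiable_sum => i; apply/differentiableZl/ex_diff.
apply: DiffDef => //; apply/funext => u.
rewrite -deriveE // derive_mx; last exact: diff_derivable.
apply/colP => i; rewrite mxE deriveE; last exact: ex_diff.
by rewrite diff_val.
Qed.

End Calculus.

Lemma is_derive_inv {R : realType} (a : R) : a != 0 ->
  is_derive a 1 (fun s : R => s^-1) (- a ^- 2).
Proof.
move=> a0; apply: DeriveDef; first exact: derivableV.
by rewrite deriveV // derive_id scaler1.
Qed.

Lemma is_diff_coord {R : realType} m n (i : 'I_m) (j : 'I_n) (x : 'M[R]_(m, n)) :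
  is_diff x (fun y : 'M[R]_(m, n) => y i j) (fun u => u i j).
Proof.
have cd := @differentiable_coord R m n x i j.
apply: DiffDef => //; apply/funext => u; rewrite -deriveE //.
have := @derive_mx R _ m n id x u (@derivable_id _ _ x u).
by rewrite derive_id => /matrixP/(_ i j); rewrite mxE.
Qed.

(** * The Euclidean product and block state vectors *)

Section EuclideanProduct.
Context {R : realType} {n : nat}.
Implicit Types (a b : R) (u v w : 'cV[R]_n).

Definition edot v w : R := \sum_i v i 0 * w i 0.

Lemma edotC v w : edot v w = edot w v.
Proof. by apply: eq_bigr => i _; rewrite mulrC. Qed.

Lemma edotDr v u w : edot v (u + w) = edot v u + edot v w.
Proof. by rewrite -big_split; apply: eq_bigr => i _; rewrite mxE mulrDr. Qed.

Lemma edotZr a v w : edot v (a *: w) = a * edot v w.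
Proof. by rewrite /edot mulr_sumr; apply: eq_bigr => i _; rewrite mxE mulrCA. Qed.

Lemma edotZl a v w : edot (a *: v) w = a * edot v w.
Proof. by rewrite edotC edotZr edotC. Qed.

Lemma edot_delta v i : edot v (delta_mx i 0) = v i 0.
Proof.
rewrite /edot (bigD1 i) //= big1 ?mxE ?eqxx ?mulr1 ?addr0 // => j /negPf ji.
by rewrite mxE ji mulr0.
Qed.

Lemma sqr_enorm v : enorm v ^+ 2 = edot v v.
Proof.
rewrite sqr_sqrtr; first by apply: eq_bigr => i _; rewrite expr2.
by apply: sumr_ge0 => i _; exact: sqr_ge0.
Qed.

End EuclideanProduct.

Section States.
Context {R : realType} {d : nat}.
Implicit Types (a b : R) (u w : 'cV[R]_d) (x : state R d).

(** The pairing of entropy variables with a flux or with a differential of U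
    splits along the blocks mass, momentum, energy. *)
Lemma mkstate_dot a u b a' u' b' :
  ((mkstate a u b)^T *m mkstate a' u' b') 0 0 = a * a' + (edot u u' + b * b').
Proof.
rewrite /mkstate !tr_col_mx !mul_row_col !tr_scalar_mx !mul_scalar_mx.
rewrite !mxE !eqxx !mulr1n; congr (_ + (_ + _)).
by apply: eq_bigr => i _; rewrite mxE.
Qed.

Lemma scale_mkstate c a u b :
  c *: mkstate a u b = mkstate (c * a) (c *: u) (c * b).
Proof. by rewrite /mkstate !scale_col_mx !scale_scalar_mx. Qed.

Lemma mkstate0 : mkstate 0 0 0 = 0 :> state R d.
Proof. by rewrite /mkstate (raddf0 (@scalar_mx R 1)) !col_mx0. Qed.

Lemma mkstate_eq0 a u b : mkstate a u b = 0 -> [/\ a = 0, u = 0 & b = 0].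
Proof.
rewrite -[0]vsubmxK => /eq_col_mx[a0].
rewrite -[dsubmx 0]vsubmxK => /eq_col_mx[u0 b0]; split.
- by move/matrixP/(_ 0 0): a0; rewrite !mxE mulr1n.
- by rewrite u0; apply/colP => i; rewrite !mxE.
- by move/matrixP/(_ 0 0): b0; rewrite !mxE mulr1n.
Qed.

Lemma mkstateK x : mkstate (rho x) (vel x) (pres x) = x.
Proof. by rewrite /mkstate /rho /vel /pres -!mx11_scalar !vsubmxK. Qed.

Lemma is_diff_mkstate (E : normedModType R) (a da b db : E -> R)
    (w dw : E -> 'cV[R]_d) (x : E) :
  is_diff x a da -> (forall i, is_diff x (fun y => w y i 0) (fun k => dw k i 0)) ->
  is_diff x b db ->
  is_diff x (fun y => mkstate (a y) (w y) (b y))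
            (fun k => mkstate (da k) (dw k) (db k)).
Proof.
move=> ad wd bd; apply: is_diff_cV => i.
have blockE (a' b' : E -> R) (w' : E -> 'cV[R]_d) :
    (fun y => mkstate (a' y) (w' y) (b' y) i 0) =
    match fintype.split i with
    | inl _ => a'
    | inr k => match fintype.split k with
               | inl l => fun y => w' y l 0
               | inr _ => b'
               end
    end.
  apply/funext => y; rewrite mxE; case: splitP => j _.
    by rewrite mxE ord1 eqxx mulr1n.
  rewrite mxE; case: splitP => l _ //.
  by rewrite mxE ord1 eqxx mulr1n.
rewrite !blockE; case: (fintype.split i) => // k.
by case: (fintype.split k).
Qed.

Lemma is_diff_rho x : is_diff x (@rho R d) (@rho R d).
Proof.
have -> : @rho R d = (fun y => y (lshift _ 0) 0) by apply/funext => y; rewrite /rho mxE.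
exact: is_diff_coord.
Qed.

Lemma is_diff_vel x i :
  is_diff x (fun y => @vel R d y i 0) (fun y => vel y i 0).
Proof.
have -> : (fun y => @vel R d y i 0) = (fun y => y (rshift _ (lshift _ i)) 0).
  by apply/funext => y; rewrite !mxE.
exact: is_diff_coord.
Qed.

Lemma is_diff_pres x : is_diff x (@pres R d) (@pres R d).
Proof.
have -> : @pres R d = (fun y => y (rshift _ (rshift _ 0)) 0).
  by apply/funext => y; rewrite /pres !mxE.
exact: is_diff_coord.
Qed.

End States.

(** * Jacobian matrices as differentials *)

Section Jacobians.
Context {R : realType}.

(** The entries of a gradient are the values of the differential on the basis,
    so by linearity the product with u is the differential at u. *)
Lemma mul_drow n (g dg : 'cV[R]_n -> R) (x u : 'cV[R]_n) :
  is_diff x g dg -> (drow g x *m u) 0 0 = dg u.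
Proof.
move=> [gd gE]; rewrite -gE {2}(matrix_sum_delta u) linear_sum mxE.
apply: eq_bigr => i _; rewrite big_ord1 linearZ !mxE deriveE //.
by rewrite mulrC.
Qed.

Lemma mul_dmx n m (f df : 'cV[R]_n -> 'cV[R]_m) (x u : 'cV[R]_n) :
  is_diff x f df -> dmx f x *m u = df u.
Proof.
move=> fd; apply/colP => i.
have fid : is_diff x (fun y => f y i 0) (fun u => df u i 0).
  exact: (is_diff_comp fd (is_diff_coord _ _ _)).
rewrite -(mul_drow _ fid) !mxE.
by apply: eq_bigr => j _; rewrite !mxE.
Qed.

Lemma row_eq_dot n (a b : 'rV[R]_n) :
  (forall u : 'cV[R]_n, (a *m u) 0 0 = (b *m u) 0 0) -> a = b.
Proof.
move=> ab; apply/rowP => j; have := ab (delta_mx j 0).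
by rewrite -!colE !mxE.
Qed.

Lemma unitmx_ker n (A : 'M[R]_n) :
  (forall u : 'cV[R]_n, A *m u = 0 -> u = 0) -> A \in unitmx.
Proof.
move=> kerA; rewrite -unitmx_tr -row_free_unit; apply: inj_row_free => v vA.
by rewrite -[v]trmxK [v^T]kerA ?trmx0 // -[A]trmxK -trmx_mul vA trmx0.
Qed.

End Jacobians.

(** * Differentials of the relativistic quantities *)

Section Differentials.
Context {R : realType} {d : nat} (e G : R -> R) (V : state R d).
Implicit Types x : state R d.

(** Each function [dq] of x below is the differential at V of the quantity q,
    in closed form. *)
Definition dlorentz x : R := lorentz V ^+ 3 * edot (vel V) (vel x).

Definition dtheta x : R := pres x / rho V - pres V * rho x / rho V ^+ 2.

Definition dmassD x : R := rho x * lorentz V + rho V * dlorentz x.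

(** The factor rho h gamma^2 common to momentum and energy: m = inertia v and
    E = inertia - p. *)
Definition inertia : R := rho V * enthalpy e (theta V) * lorentz V ^+ 2.

Definition dinertia x : R :=
  (rho x * enthalpy e (theta V) + rho V * ((1 + derive1 e (theta V)) * dtheta x))
    * lorentz V ^+ 2
  + rho V * enthalpy e (theta V) * (2 * lorentz V * dlorentz x).

Definition dconsU x : state R d :=
  mkstate (dmassD x) (inertia *: vel x + dinertia x *: vel V)
          (dinertia x - pres x).

Definition dentS x : R :=
  - (rho x / rho V) + derive1 e (theta V) / theta V * dtheta x.

Definition deta x : R := - (dmassD x * entS G V + massD V * dentS x).

End Differentials.

(** * Physical states: differentiability, invertibility, Gibbs relation *)

Section PhysicalState.
Context {R : realType} {d : nat} {e G : R -> R} {V : state R d}.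
Context (hV : physical V).
Implicit Types x : state R d.

Lemma rho_gt0 : 0 < rho V. Proof. by case: hV. Qed.

Lemma pres_gt0 : 0 < pres V. Proof. by case: hV. Qed.

Lemma theta_gt0 : 0 < theta V.
Proof. exact: divr_gt0 pres_gt0 rho_gt0. Qed.

Lemma speed2_lt1 : edot (vel V) (vel V) < 1.
Proof.
case: hV => _ v1 _; rewrite -sqr_enorm expr_lt1 //.
exact: sqrtr_ge0.
Qed.

Lemma lorentz_gt0 : 0 < lorentz V.
Proof. by rewrite invr_gt0 sqrtr_gt0 sqr_enorm subr_gt0 speed2_lt1. Qed.

(** Solving the definition of gamma for |v|^2 makes the algebraic identities
    below rational in rho, p, gamma, so that the field tactic decides them. *)
Lemma speed2E : edot (vel V) (vel V) = 1 - (lorentz V ^+ 2)^-1.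
Proof.
rewrite /lorentz exprVn invrK sqr_sqrtr; last first.
  by rewrite sqr_enorm subr_ge0 ltW ?speed2_lt1.
by rewrite sqr_enorm; ring.
Qed.

Lemma is_diff_lorentz : is_diff V (@lorentz R d) (dlorentz V).
Proof.
pose r (y : state R d) := 1 - \sum_i vel y i 0 * vel y i 0.
have lorE : @lorentz R d = (fun y => (Num.sqrt (r y))^-1).
  by apply/funext => y; rewrite /lorentz sqr_enorm.
have r_gt0 : 0 < r V by rewrite subr_gt0 speed2_lt1.
have sr_gt0 : 0 < Num.sqrt (r V) by rewrite sqrtr_gt0.
(* The leading 0 is the differential of the constant 1 in [r]. *)
have rd : is_diff V r
    (fun x => 0 - \sum_i (vel x i 0 * vel V i 0 + vel V i 0 * vel x i 0)).
  apply: is_diff_sub.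
  by apply: is_diff_bigsum => i; apply: is_diff_mul; exact: is_diff_vel.
have inv_derive := is_derive_inv (lt0r_neq0 sr_gt0).
have lord := is_diff_chain
  (is_diff_chain rd (is_derive1_sqrt r_gt0)) inv_derive.
rewrite lorE; apply: (is_diff_ext lord) => x /=; rewrite /dlorentz lorE sub0r.
have -> : \sum_i (vel x i 0 * vel V i 0 + vel V i 0 * vel x i 0)
          = 2 * edot (vel V) (vel x).
  by rewrite /edot mulr_sumr; apply: eq_bigr => i _; ring.
by field; rewrite gt_eqF.
Qed.

Lemma is_diff_theta : is_diff V (@theta R d) (dtheta V).
Proof.
have inv_derive := is_derive_inv (lt0r_neq0 rho_gt0).
have thetad := is_diff_mul (is_diff_pres V)
  (is_diff_chain (is_diff_rho V) inv_derive).
apply: (is_diff_ext thetad) => x /=.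
by rewrite /dtheta; field; rewrite gt_eqF ?rho_gt0.
Qed.

Lemma is_diff_massD : is_diff V (@massD R d) (dmassD V).
Proof. exact: is_diff_mul (is_diff_rho _) is_diff_lorentz. Qed.

Context (e_derivable : forall t : R, 0 < t -> derivable e t 1).

Lemma is_diff_inertia : is_diff V (inertia e) (dinertia e V).
Proof.
have ed : is_diff V (fun y => e (theta y))
    (fun x => dtheta V x * derive1 e (theta V)).
  apply: (is_diff_chain is_diff_theta); rewrite derive1E.
  exact/derivableP/e_derivable/theta_gt0.
have hd : is_diff V (fun y => enthalpy e (theta y))
    (fun x => (1 + derive1 e (theta V)) * dtheta V x).
  have := is_diff_add (is_diff_add (is_diff_const 1 V) ed) is_diff_theta.
  by move=> /is_diff_ext; apply=> x /=; ring.
have lor2 := is_diff_mul is_diff_lorentz is_diff_lorentz.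
have := is_diff_mul (is_diff_mul (is_diff_rho _) hd) lor2.
by move=> /is_diff_ext; apply=> x /=; rewrite /dinertia; ring.
Qed.

Lemma is_diff_consU : is_diff V (consU e) (dconsU e V).
Proof.
have momd i : is_diff V (fun y => momentum e y i 0)
    (fun x => (inertia e V *: vel x + dinertia e V x *: vel V) i 0).
  have -> : (fun y => momentum e y i 0) = (fun y => inertia e y * vel y i 0).
    by apply/funext => y; rewrite mxE.
  have := is_diff_mul is_diff_inertia (is_diff_vel V i).
  by move=> /is_diff_ext; apply=> x; rewrite !mxE addrC.
have enerd := is_diff_sub is_diff_inertia (is_diff_pres V).
exact: (@is_diff_mkstate _ _ _ _ _ _ _ (momentum e)
  (fun x => inertia e V *: vel x + dinertia e V x *: vel V) _
  is_diff_massD momd enerd).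
Qed.

Context (G_antiderivative : forall t : R, 0 < t ->
  is_derive t 1 G (derive1 e t / t)).

Lemma is_diff_eta : is_diff V (eta G) (deta e G V).
Proof.
have Gd := is_diff_chain is_diff_theta (G_antiderivative theta_gt0).
have lnd := is_diff_chain (is_diff_rho V) (is_derive1_ln rho_gt0).
have Sd : is_diff V (entS G) (dentS e V).
  have := is_diff_add (is_diff_opp lnd) Gd.
  by move=> /is_diff_ext; apply=> x /=; congr (_ + _); exact: mulrC.
exact: (is_diff_opp (is_diff_mul is_diff_massD Sd)).
Qed.

Context (de_gt0 : forall t : R, 0 < t -> 0 < derive1 e t).
Context (h_gt : forall t : R, 0 < t ->
  t * (1 + derive1 e t) / derive1 e t < enthalpy e t).

Lemma enthalpy_gt0 : 0 < enthalpy e (theta V).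
Proof.
have t0 := theta_gt0; have e0 := de_gt0 t0; apply: lt_trans (h_gt t0).
exact: divr_gt0 (mulr_gt0 t0 (addr_gt0 ltr01 e0)) e0.
Qed.

Lemma inertia_gt0 : 0 < inertia e V.
Proof. exact: mulr_gt0 (mulr_gt0 rho_gt0 enthalpy_gt0) (exprn_gt0 2 lorentz_gt0). Qed.

(** The step where the bounds on the equation of state enter: all unknowns are
    multiples of dp, and dp is killed by e' h > theta (1 + e') |v|^2. *)
Lemma dconsU_ker x : dconsU e V x = 0 -> x = 0.
Proof.
case/mkstate_eq0 => dD0 dm0 /eqP; rewrite subr_eq0 => /eqP dk.
have r0 := rho_gt0; have g0 := lorentz_gt0.
have h0 := enthalpy_gt0; have k0 := inertia_gt0.
have t0 := theta_gt0; have e0 := de_gt0 t0.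
have := h_gt t0; rewrite ltr_pdivrMr // => h_lb.
have s1 := speed2_lt1.
(* The momentum equation contracted with v. *)
have wE : inertia e V * edot (vel V) (vel x)
          + pres x * edot (vel V) (vel V) = 0.
  rewrite -edotZr -edotZr -edotDr -dk dm0.
  by rewrite -(scale0r (vel V)) edotZr mul0r.
have sE := speed2E.
have rho_neq0 : rho V != 0 by rewrite gt_eqF.
have g_neq0 : lorentz V != 0 by rewrite gt_eqF.
have h_neq0 : enthalpy e (theta V) != 0 by rewrite gt_eqF.
have k_neq0 : inertia e V != 0 by rewrite gt_eqF.
have {}wE : edot (vel V) (vel x)
    = - (pres x * (1 - (lorentz V ^+ 2)^-1)) / inertia e V.
  rewrite -sE; apply: (mulfI k_neq0); rewrite mulrCA divff // mulr1.
  by apply/eqP; rewrite -addr_eq0 wE.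
have rE : rho x = pres x * (1 - (lorentz V ^+ 2)^-1) / enthalpy e (theta V).
  apply: (mulIf g_neq0); apply/eqP; rewrite -subr_eq0 -dD0 /dmassD /dlorentz wE.
  by rewrite /inertia; apply/eqP; field; rewrite h_neq0 g_neq0 rho_neq0.
have dp0 : pres x = 0.
  apply/eqP; apply: contraTT isT => px0.
  have : pres x * (derive1 e (theta V) * enthalpy e (theta V)
      - theta V * (1 + derive1 e (theta V)) * edot (vel V) (vel V)) = 0.
    (* The multiplier clears the denominators of the energy equation once w and
       drho are expressed through dp. *)
    transitivity ((dinertia e V x - pres x) * enthalpy e (theta V) / lorentz V ^+2).
      rewrite /dinertia /dtheta /dlorentz wE rE sE /inertia.
      set h := enthalpy _ _ in h_neq0 *; set e' := derive1 _ _; rewrite /theta.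
      by field; rewrite h_neq0 g_neq0 rho_neq0.
    by rewrite dk subrr !mul0r.
  move/eqP; rewrite mulf_eq0 (negPf px0) /= => /eqP.
  have : theta V * (1 + derive1 e (theta V)) * edot (vel V) (vel V) <=
         theta V * (1 + derive1 e (theta V)).
    exact: ler_piMr (ltW (mulr_gt0 t0 (addr_gt0 ltr01 e0))) (ltW s1).
  lra.
have vel0 : vel x = 0.
  move: dm0; rewrite dk dp0 scale0r addr0 => /eqP.
  by rewrite scaler_eq0 (negPf k_neq0) => /eqP.
have rho0 : rho x = 0 by rewrite rE dp0 !mul0r.
by rewrite -[x]mkstateK dp0 vel0 rho0 mkstate0.
Qed.

(** The Gibbs relation in conservative variables, d eta = W . dU; it
    characterises W once dU is known to be invertible. *)
Lemma deta_dconsU x :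
  deta e G V x =
  (((theta V)^-1 *: mkstate (enthalpy e (theta V) - theta V * entS G V)
       (lorentz V *: vel V) (- lorentz V))^T *m dconsU e V x) 0 0.
Proof.
have rho_neq0 : rho V != 0 by rewrite gt_eqF ?rho_gt0.
have p_neq0 : pres V != 0 by rewrite gt_eqF ?pres_gt0.
have g_neq0 : lorentz V != 0 by rewrite gt_eqF ?lorentz_gt0.
rewrite scale_mkstate mkstate_dot.
rewrite !(edotDr, edotZl, edotZr) speed2E //.
rewrite /deta /dentS /dmassD /massD /dinertia /inertia /dtheta /dlorentz.
set h := enthalpy _ _; set e' := derive1 _ _; rewrite /theta.
by field; rewrite rho_neq0 p_neq0 g_neq0.
Qed.

End PhysicalState.

(** * Entropy variables and potential fluxes *)

Theorem theorem3 (R : realType) (d : nat) (hd : (1 <= d <= 3)%N)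
    (e G : R -> R)
    (e_derivable : forall t : R, 0 < t -> derivable e t 1)
    (e_C1 : forall t : R, 0 < t -> {for t, continuous (derive1 e)})
    (de_gt0 : forall t : R, 0 < t -> 0 < derive1 e t)
    (h_gt : forall t : R, 0 < t ->
      t * (1 + derive1 e t) / derive1 e t < enthalpy e t)
    (G_antiderivative : forall t : R, 0 < t ->
      is_derive t 1 G (derive1 e t / t))
    (V : state R d) (hV : physical V) :
  (* d U / d V and d eta / d V exist, and the former is invertible *)
  [/\ differentiable (consU e) V,
      differentiable (eta G) V &
      dmx (consU e) V \in unitmx] /\
  entropy_vars e G V =
    (theta V)^-1 *: mkstate (enthalpy e (theta V) - theta V * entS G V)
                            (lorentz V *: vel V)
                            (- lorentz V) /\
  (forall i : 'I_d, potential_flux e G i V = rho V * lorentz V * vel V i 0).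
Proof.
have Ud := is_diff_consU hV e_derivable.
have etad := is_diff_eta hV G_antiderivative.
have J_unit : dmx (consU e) V \in unitmx.
  apply: unitmx_ker => x; rewrite (mul_dmx _ Ud).
  exact: dconsU_ker.
have WE : entropy_vars e G V =
    (theta V)^-1 *: mkstate (enthalpy e (theta V) - theta V * entS G V)
                            (lorentz V *: vel V) (- lorentz V).
  set W := RHS; apply: trmx_inj; rewrite /entropy_vars trmxK /drow_wrt.
  suff -> : drow (eta G) V = W^T *m dmx (consU e) V by rewrite mulmxK.
  apply: row_eq_dot => x.
  rewrite (mul_drow _ etad) -mulmxA (mul_dmx _ Ud).
  exact: deta_dconsU.
split; first by split=> //; exact: ex_diff.
split=> // i; rewrite /potential_flux WE scale_mkstate mkstate_dot.
have rho_neq0 : rho V != 0 by rewrite gt_eqF ?rho_gt0.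
have p_neq0 : pres V != 0 by rewrite gt_eqF ?pres_gt0.
have g_neq0 : lorentz V != 0 by rewrite gt_eqF ?lorentz_gt0.
rewrite !(edotDr, edotZl, edotZr) edot_delta speed2E // !mxE /massD.
set h := enthalpy _ _; rewrite /theta.
by field; rewrite rho_neq0 p_neq0 g_neq0.
Qed.
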